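(* Let $\alpha=\{k_1,\dots,k_p\}$ be a partition of $N$ with $p\ge2$. Then the set $\mathcal{FW}_{\alpha,2}^N$ of block factor-width-two matrices is a proper cone in $\mathbb S^N$: it is a cone that is closed, convex, pointed (it contains the zero matrix), salient (for every nonzero $X\in\mathcal{FW}_{\alpha,2}^N$ one has $-X\notin\mathcal{FW}_{\alpha,2}^N$), and has non-empty interior.
   Context: $\mathbb S^n$ denotes the real symmetric $n\times n$ matrices and $\mathbb S^n_+$ the positive semidefinite ones; topological notions are those of the finite-dimensional real vector space $\mathbb S^N$. A partition $\alpha=\{k_1,\dots,k_p\}$ of $N$ is an ordered list of positive integers with $\sum_{i=1}^p k_i=N$. For such $\alpha$, let $E_i=\begin{bmatrix}0&\cdots&I_{k_i}&\cdots&0\end{bmatrix}\in\mathbb R^{k_i\times N}$ be the $i$-th block row of the $N\times N$ identity matrix partitioned according to $\alpha$, and for $i\ne j$ let $E_{ij}=\begin{bmatrix}E_i^T& E_j^T\end{bmatrix}^T\in\mathbb R^{(k_i+k_j)\times N}$. $\mathcal{FW}_{\alpha,2}^N$ is the set of matrices $X\in\mathbb S^N$ of the form $X=\sum_{i=1}^{p-1}\sum_{j=i+1}^p E_{ij}^TX_{ij}E_{ij}$ with $X_{ij}\in\mathbb S_+^{k_i+k_j}$. *)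

(* Defs.v *)
From HB Require Import structures.
From mathcomp Require Import all_boot all_order all_algebra.
From mathcomp Require Import all_classical all_reals all_analysis.

Set Implicit Arguments.
Unset Strict Implicit.
Unset Printing Implicit Defensive.

Import Order.TTheory GRing.Theory Num.Theory.
Import numFieldNormedType.Exports.

Local Open Scope classical_set_scope.
Local Open Scope ring_scope.

(* The real symmetric matrices as a type of their own, so that "closed" and
   "interior" below refer to the space S^n and not to the ambient 'M[R]_n, in
   which any set of symmetric matrices has empty interior as soon as n >= 2. *)
Record symmat (R : realType) (n : nat) : Type :=
  Symmat { symmat_val :> 'M[R]_n; _ : symmat_val \is symmetricmx }.

Lemma symmetricmxP (R : realType) (n : nat) (A : 'M[R]_n) :
  reflect (A^T = A) (A \is symmetricmx).
Proof.
rewrite is_hermitianmxE expr0 scale1r map_mx_id // eq_sym.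
exact: eqP.
Qed.

Section SymmatInstances.
Variables (R : realType) (n : nat).

HB.instance Definition _ := [isSub for @symmat_val R n].
HB.instance Definition _ := [Choice of symmat R n by <:].

Fact symmetricmx_submod_closed :
  submod_closed (fun A : 'M[R]_n => A \is symmetricmx).
Proof.
split; first by apply/symmetricmxP; rewrite trmx0.
move=> a A B /symmetricmxP sA /symmetricmxP sB; apply/symmetricmxP.
by rewrite linearP /= sA sB.
Qed.

HB.instance Definition _ := GRing.SubChoice_isSubLmodule.Build
  R 'M[R]_n _ (symmat R n) symmetricmx_submod_closed.

HB.instance Definition _ :=
  Topological.copy (symmat R n) (initial_topology (@symmat_val R n)).

Let valc : continuous (@symmat_val R n).
Proof. exact: initial_continuous. Qed.

Let to_symmat_continuous (T : topologicalType) (f : T -> symmat R n) :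
  continuous (@symmat_val R n \o f) -> continuous f.
Proof.
move=> /continuousP cf; apply/continuousP => _ [B oB <-].
exact: cf.
Qed.

Fact symmat_add_continuous :
  continuous (fun x : symmat R n * symmat R n => x.1 + x.2).
Proof.
apply: to_symmat_continuous => x.
apply: (@cvgD _ 'M[R]_n (symmat R n * symmat R n)%type).
  by apply: continuous_comp; [exact: cvg_fst|exact: valc].
by apply: continuous_comp; [exact: cvg_snd|exact: valc].
Qed.

HB.instance Definition _ :=
  PreTopologicalNmodule_isTopologicalNmodule.Build (symmat R n)
    symmat_add_continuous.

Fact symmat_scale_continuous :
  continuous (fun z : R^o * symmat R n => z.1 *: z.2).
Proof.
apply: to_symmat_continuous => x.
apply: (@cvgZ _ 'M[R]_n (R^o * symmat R n)%type).
  exact: cvg_fst.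
by apply: continuous_comp; [exact: cvg_snd|exact: valc].
Qed.

HB.instance Definition _ :=
  TopologicalNmodule_isTopologicalLmodule.Build R (symmat R n)
    symmat_scale_continuous.

End SymmatInstances.

Definition psd_cone (R : realType) (n : nat) : set (symmat R n) :=
  [set A | forall x : 'cV[R]_n, 0 <= (x^T *m A *m x) 0 0].

(* An ordered list of positive integers with sum N. *)
Record block_partition (N : nat) := BlockPartition {
  nblocks : nat;
  block_size :> 'I_nblocks -> nat;
  block_size_gt0 : forall i, (0 < block_size i)%N;
  sum_block_size : (\sum_i block_size i)%N = N
}.

Section BlockFactorWidthTwo.
Variables (R : realType) (N : nat) (alpha : block_partition N).
Implicit Types i j : 'I_(nblocks alpha).

(* The i-th block row of the N x N identity matrix; the cast identifies the
   column index type 'I_(\sum_i alpha i) with 'I_N. *)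
Definition block_row i : 'M[R]_(alpha i, N) :=
  castmx (erefl, sum_block_size alpha) (submxcol 1%:M i).

Definition block_row2 i j : 'M[R]_(alpha i + alpha j, N) :=
  col_mx (block_row i) (block_row j).

(* Only the entries X i j with i < j are constrained or used. *)
Definition FW2 : set (symmat R N) :=
  [set S | exists X : forall i j, symmat R (alpha i + alpha j),
     (forall i j, (i < j)%N -> psd_cone (X i j)) /\
     symmat_val S = \sum_(i < nblocks alpha) \sum_(j < nblocks alpha | (i < j)%N)
       (block_row2 i j)^T *m X i j *m block_row2 i j].

End BlockFactorWidthTwo.

Arguments FW2 R {N} alpha _.

(* "Pointed" means here that the cone contains 0, and "salient" that it
   contains no line through 0. *)
Record proper_cone (R : realType) (V : topologicalLmodType R) (K : set V)
    : Prop := ProperCone {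
  proper_cone_scale : forall (a : R) X, 0 <= a -> K X -> K (a *: X);
  proper_cone_closed : closed K;
  proper_cone_convex : convex_set (K : set (convex_lmodType V));
  proper_cone_pointed : K 0;
  proper_cone_salient : forall X, K X -> X <> 0 -> ~ K (- X);
  proper_cone_interior : K° !=set0
}.

(* Main.v *)
(** Since [E_ij E_ij^T = 1], the trace of an element of the cone is the sum of
    the traces of the [X_ij].  The trace of a positive semidefinite matrix
    bounds its entries; hence the part of the cone with bounded trace is
    the continuous image of a compact set of families of summands, so the cone
    is closed, and a matrix of the cone with zero trace vanishes, so the cone is
    salient.  For the interior, let [c a b] be the number of pairs
    of blocks that cover both indices [a] and [b].  If [S] is close to the
    diagonal matrix with entries [c a a], then [T = (S a b / c a b)] is
    diagonally dominant, hence positive semidefinite, and [S] is the sum of the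
    [E_ij^T (E_ij T E_ij^T) E_ij]. *)

Require Import Defs.
From mathcomp Require Import all_boot all_order all_algebra.
From mathcomp Require Import all_classical all_reals all_analysis.
From mathcomp Require Import ring lra.

Set Implicit Arguments.
Unset Strict Implicit.
Unset Printing Implicit Defensive.

Import Order.TTheory GRing.Theory Num.Theory.
Import numFieldNormedType.Exports.

Local Open Scope classical_set_scope.
Local Open Scope ring_scope.

(** * Positive semidefinite matrices *)

Section PositiveSemidefinite.
Variable R : realType.

(** Symmetry is part of the predicate, so that sums, limits and compactness can be handled in
    ['M[R]_n] instead of [symmat]. *)
Definition psdmx n (A : 'M[R]_n) : Prop :=
  A^T = A /\ forall x : 'cV[R]_n, 0 <= (x^T *m A *m x) 0 0.

Lemma psdmx0 n : psdmx (0 : 'M[R]_n).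
Proof. by split=> [|x]; rewrite ?trmx0// mulmx0 mul0mx mxE. Qed.

Lemma psdmxD n (A B : 'M[R]_n) : psdmx A -> psdmx B -> psdmx (A + B).
Proof.
move=> [sA pA] [sB pB]; split=> [|x]; first by rewrite linearD/= sA sB.
by rewrite mulmxDr mulmxDl mxE addr_ge0.
Qed.

Lemma psdmxZ n (a : R) (A : 'M[R]_n) : 0 <= a -> psdmx A -> psdmx (a *: A).
Proof.
move=> a0 [sA pA]; split=> [|x]; first by rewrite linearZ/= sA.
by rewrite -scalemxAr -scalemxAl mxE mulr_ge0.
Qed.

Lemma psdmx_congruence m n (E : 'M[R]_(m, n)) (A : 'M[R]_m) :
  psdmx A -> psdmx (E^T *m A *m E).
Proof.
move=> [sA pA]; split=> [|x]; first by rewrite !trmx_mul trmxK sA mulmxA.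
by have := pA (E *m x); rewrite trmx_mul !mulmxA.
Qed.

Lemma delta_form n (A : 'M[R]_n) i j :
  ((delta_mx i 0 : 'cV[R]_n)^T *m A *m (delta_mx j 0 : 'cV[R]_n)) 0 0 = A i j.
Proof. by rewrite trmx_delta -rowE -colE !mxE. Qed.

Lemma psdmx_diag_ge0 n (A : 'M[R]_n) i : psdmx A -> 0 <= A i i.
Proof. by case=> _ /(_ (delta_mx i 0)); rewrite delta_form. Qed.

Lemma psdmx_trace_ge0 n (A : 'M[R]_n) : psdmx A -> 0 <= \tr A.
Proof. by move=> pA; apply: sumr_ge0 => i _; apply: psdmx_diag_ge0. Qed.


Lemma form_delta_combination n (A : 'M[R]_n) i j (s : R) : A^T = A ->
  let x : 'cV[R]_n := delta_mx i 0 + s *: delta_mx j 0 in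
  (x^T *m A *m x) 0 0 = A i i + 2 * s * A i j + s ^+ 2 * A j j.
Proof.
move=> sA x; have Aji : A j i = A i j by rewrite -{1}sA mxE.
have -> : (x^T *m A *m x) 0 0 = A i i + s * A i j + s * (A j i + s * A j j).
  have -> : x^T = (delta_mx i 0)^T + s *: (delta_mx j 0)^T.
    by rewrite linearD linearZ.
  rewrite /x -!(delta_form A) !mulmxDl !mulmxDr -!scalemxAl -!scalemxAr.
  have addE (B C : 'M[R]_1) : (B + C) 0 0 = B 0 0 + C 0 0 by rewrite mxE.
  have scaleE a (B : 'M[R]_1) : (a *: B) 0 0 = a * B 0 0 by rewrite mxE.
  by rewrite !(addE, scaleE); ring.
rewrite Aji; ring.
Qed.

(** The form at [e_i + e_j] and at [e_i - e_j] gives [2 |A i j| <= A i i + A j j], and each diagonal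
    entry is at most the trace since the others are nonnegative. *)
Lemma psdmx_entry_le_trace n (A : 'M[R]_n) i j : psdmx A -> `|A i j| <= \tr A.
Proof.
move=> pA; have diag_le k : A k k <= \tr A.
  rewrite /mxtrace (bigD1 k)//= lerDl.
  by apply: sumr_ge0 => l _; apply: psdmx_diag_ge0.
have [sA qA] := pA.
have := qA (delta_mx i 0 + 1 *: delta_mx j 0); rewrite form_delta_combination//.
have := qA (delta_mx i 0 + (-1) *: delta_mx j 0); rewrite form_delta_combination//.
have := diag_le i; have := diag_le j; rewrite ler_norml.
move=> *; apply/andP; split; lra.
Qed.

Lemma formE n (A : 'M[R]_n) (x : 'cV[R]_n) :
  (x^T *m A *m x) 0 0 = \sum_i \sum_j A i j * (x i 0 * x j 0).
Proof.
rewrite mxE exchange_big/=; apply: eq_bigr => j _.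
by rewrite mxE mulr_suml; apply: eq_bigr => i _; rewrite mxE; ring.
Qed.

(** Each off-diagonal term satisfies [A i j * x_i * x_j >= - |A i j| (x_i^2 + x_j^2) / 2]. By
    symmetry these bounds add up to [- offdiag], which the diagonal terms compensate by
    dominance. *)
Lemma diagonally_dominant_psdmx n (A : 'M[R]_n) : A^T = A ->
  (forall i, \sum_(j | j != i) `|A i j| <= A i i) -> psdmx A.
Proof.
move=> sA dA; split=> // x; rewrite formE.
have Aji i j : A j i = A i j by rewrite -{1}sA mxE.
pose offdiag := \sum_i \sum_(j | j != i) `|A i j| * x i 0 ^+ 2.
have offdiagC : offdiag = \sum_i \sum_(j | j != i) `|A i j| * x j 0 ^+ 2.
  rewrite /offdiag (exchange_big_dep xpredT)//=; apply: eq_bigr => i _.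
  by apply: eq_big => [j|j _]; rewrite 1?eq_sym// Aji.
have diag_ge : offdiag <= \sum_i A i i * x i 0 ^+ 2.
  by apply: ler_sum => i _; rewrite -mulr_suml ler_wpM2r// sqr_ge0.
have off_ge : - offdiag <= \sum_i \sum_(j | j != i) A i j * (x i 0 * x j 0).
  have -> : - offdiag =
      \sum_i \sum_(j | j != i) - (`|A i j| * (x i 0 ^+ 2 + x j 0 ^+ 2) / 2).
    (* One copy of [offdiag] carries [x_i^2], the other, after exchanging indices, [x_j^2]. *)
    have -> : - offdiag = - ((offdiag + offdiag) / 2) by field.
    rewrite {2}offdiagC -big_split/= mulr_suml -sumrN.
    apply: eq_bigr => i _; rewrite -big_split/= mulr_suml -sumrN.
    by apply: eq_bigr => j _; rewrite mulrDr.
  apply: ler_sum => i _; apply: ler_sum => j _.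
  have := sqr_ge0 (x i 0 + x j 0); have := sqr_ge0 (x i 0 - x j 0).
  by case: (ger0P (A i j)) => ? ? ?; nra.
under eq_bigr => i _ do rewrite (bigD1 i)//=.
rewrite big_split/= -[leLHS](subrr offdiag).
apply: lerD => //; apply: le_trans diag_ge _; apply: ler_sum => i _; rewrite expr2.
Qed.

End PositiveSemidefinite.

(** * Entrywise topology of matrix spaces *)

Lemma continuous_mx (T U : topologicalType) m n (f : T -> 'M[U]_(m, n)) :
  (forall i j, continuous (fun t => f t i j)) -> continuous f.
Proof.
move=> cf t A [P fP sPA].
apply: (@filterS _ _ _ (fun u => forall i j, P i j (f u i j))).
  by move=> u Pu; apply: sPA.
by do 2!apply: filter_forall => ?; apply/cf/fP.
Qed.

Section MatrixTopology.
Variable R : realType.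

Lemma continuous_mulmx (T : topologicalType) m n p
    (f : T -> 'M[R]_(m, n)) (g : T -> 'M[R]_(n, p)) :
  continuous f -> continuous g -> continuous (fun t => f t *m g t).
Proof.
have coordc q r (h : T -> 'M[R]_(q, r)) i j :
    continuous h -> continuous (fun t => h t i j).
  move=> ch t; exact: (cvg_comp _ _ (ch t) (@coord_continuous R q r i j (h t))).
move=> cf cg; apply: continuous_mx => i j.
under eq_fun do rewrite mxE.
apply: continuous_big => [|k _]; first exact: add_continuous.
move=> t; apply: (@continuousM R T (fun t => f t i k) (fun t => g t k j) t);
  [exact: (coordc _ _ _ _ _ cf)|exact: (coordc _ _ _ _ _ cg)].
Qed.

Lemma nbhs_entrywise m n (A : 'M[R]_(m, n)) (e : R) : 0 < e ->
  nbhs A [set B | forall i j, `|A i j - B i j| < e].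
Proof.
move=> e0; exists (fun i j => ball (A i j) e) => // i j.
exact: nbhsx_ballx.
Qed.

Lemma continuous_mxtrace n : continuous (fun A : 'M[R]_n => \tr A).
Proof.
apply: continuous_big => [|k _]; first exact: add_continuous.
exact: coord_continuous.
Qed.

(** The set is the image under the continuous map [vec_mx] of a cube of row vectors, a product of
    compact segments. *)
Lemma compact_bounded_mx m n (c : R) :
  compact [set A : 'M[R]_(m, n) | forall i j, `|A i j| <= c].
Proof.
have -> : [set A : 'M[R]_(m, n) | forall i j, `|A i j| <= c] =
    vec_mx @` [set v : 'rV[R]_(m * n) | forall k, `[- c, c]%classic (v ord0 k)].
  apply/seteqP; split=> [A Ac|_ [v vc <-] i j]/=.
    exists (mxvec A); last exact: mxvecK.
    by case/mxvec_indexP=> i j; rewrite mxvecE/= in_itv/= -ler_norml.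
  by rewrite mxE ler_norml; have := vc (mxvec_index i j); rewrite /= in_itv.
apply: continuous_compact; last first.
  apply: (@rV_compact R (m * n) (fun=> `[- c, c]%classic)) => k.
  exact: segment_compact.
apply: continuous_subspaceT; apply: continuous_mx => i j.
under eq_fun do rewrite mxE.
exact: coord_continuous.
Qed.

End MatrixTopology.

(** * Block rows and sums over pairs of blocks *)

Section Blocks.
Variables (R : realType) (N : nat) (alpha : block_partition N).
Local Notation p := (nblocks alpha).
Local Notation E := (@block_row R N alpha).
Local Notation E2 k := (@block_row2 R N alpha k.1 k.2).

Definition block_of (a : 'I_N) : 'I_p :=
  tagnat.sig1 (cast_ord (esym (sum_block_size alpha)) a).

Lemma block_rowE i u a :
  E i u a = (tagnat.Rank i u == cast_ord (esym (sum_block_size alpha)) a)%:R.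
Proof. by rewrite castmxE !mxE; congr (tagnat.Rank i _ == _)%:R; apply/val_inj. Qed.

Lemma block_row_mul_tr i j u v :
  (E i *m (E j)^T) u v = (tagnat.Rank i u == tagnat.Rank j v)%:R.
Proof.
(* [c] is the only column in which row [u] of [E i] is nonzero. *)
pose c := cast_ord (sum_block_size alpha) (tagnat.Rank i u).
rewrite mxE (bigD1 c)//= big1 ?addr0 => [|a ac]; rewrite mxE !block_rowE.
  by rewrite cast_ordK eqxx mul1r eq_sym.
rewrite [_ == _](_ : _ = false) ?mul0r//.
by apply: contraNF ac => /eqP; rewrite /c => ->; rewrite cast_ordKV.
Qed.

(** For [i != j] the rows of [E_ij] are distinct rows of the identity, hence orthonormal. *)
Lemma block_row2_mul_tr (i j : 'I_p) : i != j ->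
  block_row2 R i j *m (block_row2 R i j)^T = 1%:M.
Proof.
move=> ij; rewrite /block_row2 tr_col_mx mul_col_row scalar_mx_block.
congr block_mx; apply/matrixP => u v; rewrite block_row_mul_tr !mxE.
all: rewrite -val_eqE/= tagnat.eq_Rank ?eqxx//.
  by rewrite (negPf ij).
by rewrite eq_sym (negPf ij).
Qed.

(** This is an entry of [E_i^T E_i]: only the position of [c] inside its block can contribute, and
    only if that block is [i]. *)
Lemma sum_Rank_eq i (c d : 'I_(\sum_i alpha i)) :
  \sum_u (tagnat.Rank i u == c)%:R * (tagnat.Rank i u == d)%:R =
  ((c == d) && (tagnat.sig1 c == i))%:R :> R.
Proof.
have [ci|ci] := eqVneq (tagnat.sig1 c) i; last first.
  rewrite andbF big1// => u _; rewrite [_ == c](_ : _ = false) ?mul0r//.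
  by apply: contraNF ci => /eqP <-; rewrite tagnat.Rank1K.
case: _ / ci; rewrite andbT (bigD1 (tagnat.sig2 c))//= [X in _ + X]big1 => [|u uc].
  by rewrite tagnat.sig2K eqxx mul1r addr0.
rewrite [_ == c](_ : _ = false) ?mul0r//.
apply: contraNF uc => /eqP uc; have := congr1 val uc.
rewrite -[in RHS](tagnat.sig2K c) => /eqP.
by rewrite tagnat.eq_Rank eqxx.
Qed.

Lemma tr_block_row_mul i :
  (E i)^T *m E i = diag_mx (\row_a (block_of a == i)%:R).
Proof.
apply/matrixP => a b; rewrite !mxE.
under eq_bigr do rewrite mxE !block_rowE.
rewrite sum_Rank_eq (inj_eq (@cast_ord_inj _ _ _)) -/(block_of a).
by case: eqP; rewrite ?mulr0n.
Qed.

Definition in_pair (k : 'I_p * 'I_p) (a : 'I_N) : bool :=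
  (block_of a == k.1) || (block_of a == k.2).

(** The product is [E_i^T E_i + E_j^T E_j]; the two blocks are disjoint, so the sum of their
    indicators is the indicator of their union. *)
Lemma tr_block_row2_mul (k : 'I_p * 'I_p) : k.1 != k.2 ->
  (E2 k)^T *m E2 k = diag_mx (\row_a (in_pair k a)%:R).
Proof.
move=> k12; rewrite /block_row2 tr_col_mx mul_row_col !tr_block_row_mul -linearD.
congr diag_mx; apply/rowP => a; rewrite !mxE /in_pair.
case: eqVneq => [->|_]/=; last by rewrite add0r.
by rewrite (negPf k12) addr0.
Qed.

(** A single dependent function on all ordered pairs, so that families form a product of matrix
    spaces, as Tychonoff's theorem requires. *)
Definition pair_family :=
  forall k : 'I_p * 'I_p, 'M[R]_(alpha k.1 + alpha k.2).

Definition assemble (X : pair_family) : 'M[R]_N :=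
  \sum_(k : 'I_p * 'I_p | (k.1 < k.2)%N) (E2 k)^T *m X k *m E2 k.

Lemma assembleD (X Y : pair_family) :
  assemble (fun k => X k + Y k) = assemble X + assemble Y.
Proof.
by rewrite -big_split; apply: eq_bigr => k _; rewrite mulmxDr mulmxDl.
Qed.

Lemma assembleZ (a : R) (X : pair_family) :
  assemble (fun k => a *: X k) = a *: assemble X.
Proof.
by rewrite scaler_sumr; apply: eq_bigr => k _; rewrite -scalemxAr -scalemxAl.
Qed.

Lemma mxtrace_assemble (X : pair_family) :
  \tr (assemble X) = \sum_(k : 'I_p * 'I_p | (k.1 < k.2)%N) \tr (X k).
Proof.
rewrite raddf_sum; apply: eq_bigr => k k12 /=.
rewrite mxtrace_mulC mulmxA block_row2_mul_tr ?mul1mx//.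
by rewrite -val_eqE/= neq_ltn k12.
Qed.

Lemma psdmx_assemble (X : pair_family) :
  (forall k, psdmx (X k)) -> psdmx (assemble X).
Proof.
move=> pX; rewrite /assemble.
by apply: big_ind => [||k _];
  [exact: psdmx0|exact: psdmxD|exact: psdmx_congruence].
Qed.

(** Asking positivity at every pair turns the condition on families into a product of identical
    kinds of sets. The pairs with [k.1 >= k.2] can be filled with zero matrices. *)
Lemma FW2P (S : symmat R N) : FW2 R alpha S <->
  exists X : pair_family, (forall k, psdmx (X k)) /\ symmat_val S = assemble X.
Proof.
split=> -[X [pX SX]].
  exists (fun k : 'I_p * 'I_p => if (k.1 < k.2)%N then symmat_val (X k.1 k.2) else 0); split.
    move=> k; case: ifP => k12; last exact: psdmx0.
    by split; [apply/symmetricmxP; case: (X k.1 k.2)|exact: pX].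
  rewrite SX pair_big_dep; apply: eq_big => //= k k12; by rewrite k12.
have sX k : X k \is symmetricmx by apply/symmetricmxP; case: (pX k).
exists (fun i j => Symmat (sX (i, j))); split=> [i j _|].
  by case: (pX (i, j)).
by rewrite SX pair_big_dep; apply: eq_bigr => -[].
Qed.

End Blocks.

(** * Closedness through compactness *)

Section ClosedCone.
Variable R : realType.

(** Symmetry and, for each [x], nonnegativity of the form at [x] are closed conditions, being
    preimages of closed sets under continuous maps. *)
Lemma closed_psdmx n : closed [set A : 'M[R]_n | psdmx A].
Proof.
have -> : [set A : 'M[R]_n | psdmx A] =
    (fun A : 'M[R]_n => A^T - A) @^-1` [set 0] `&` \bigcap_(x in [set: 'cV[R]_n])
      (fun A : 'M[R]_n => (x^T *m A *m x) 0 0) @^-1` [set y | 0 <= y].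
  apply/seteqP; split=> A [sA pA]; split.
  - by rewrite /= sA subrr.
  - by move=> x _; apply: pA.
  - by apply/eqP; rewrite -subr_eq0; apply/eqP.
  - by move=> x; apply: (pA x).
apply: closedI.
  apply: preimage_closed; last first.
    by apply: accessible_closed_set1; apply: hausdorff_accessible; exact: norm_hausdorff.
  move=> A _; apply: continuous_mx => i j {}A; under eq_fun do rewrite !mxE.
  exact: (@cvgB R R^o _ _ _ _ _ _ _ (@coord_continuous R n n j i A)
    (@coord_continuous R n n i j A)).
apply: closed_bigI => x _; apply: preimage_closed; last exact: closed_ge.
move=> A _.
have form_cont : continuous (fun A : 'M[R]_n => x^T *m A *m x).
  apply: continuous_mulmx; last exact: cst_continuous.
  apply: (@continuous_mulmx R _ _ _ _ (fun=> x^T) id); first exact: cst_continuous.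
  by move=> B; apply: cvg_id.
exact: (cvg_comp _ _ (form_cont A) (@coord_continuous R 1 1 0 0 _)).
Qed.

Lemma compact_psdmx_trace n (c : R) :
  compact [set A : 'M[R]_n | psdmx A /\ \tr A <= c].
Proof.
apply: (subclosed_compact _ (@compact_bounded_mx R n n c)).
  apply: closedI; first exact: closed_psdmx.
  apply: (@preimage_closed _ _ _ [set y : R | y <= c]); last exact: closed_le.
  by move=> A _; apply: continuous_mxtrace.
by move=> A [pA Ac] i j; apply: le_trans Ac; apply: psdmx_entry_le_trace.
Qed.

Variables (N : nat) (alpha : block_partition N).
Local Notation p := (nblocks alpha).

Lemma continuous_assemble : continuous (@assemble R N alpha :
  prod_topology (fun k : 'I_p * 'I_p => 'M[R]_(alpha k.1 + alpha k.2)) -> 'M[R]_N).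
Proof.
apply: continuous_big => [|k _]; first exact: add_continuous.
apply: continuous_mulmx; last exact: cst_continuous.
apply: continuous_mulmx; first exact: cst_continuous.
exact: proj_continuous.
Qed.

Lemma closed_assemble_psdmx : closed [set A : 'M[R]_N |
  exists X : pair_family R alpha, (forall k, psdmx (X k)) /\ A = assemble X].
Proof.
(* The bound exceeds [\tr A] strictly, so all matrices near [A] have trace below [c]. *)
move=> A clA; pose c := \tr A + 1.
pose V := prod_topology
  (fun k : 'I_p * 'I_p => 'M[R]_(alpha k.1 + alpha k.2)).
pose B : set V := [set X | forall k, psdmx (X k) /\ \tr (X k) <= c].
pose K := (@assemble R N alpha : V -> _) @` B.
have closedK : closed K.
  apply: compact_closed; first exact: norm_hausdorff.
  apply: (@continuous_compact V).
    exact/continuous_subspaceT/continuous_assemble.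
  by apply: (@tychonoff _ _ (fun k => [set A | psdmx A /\ \tr A <= c])) => k; apply: compact_psdmx_trace.
(* Since [K] is closed, it is enough that every neighbourhood of [A] meets [K]. *)
suff /closedK[X pX <-] : closure K A by exists X; split=> // k; case: (pX k).
move=> U nU.
have nV : nbhs A [set B | \tr B < c].
  apply: (@continuous_mxtrace R N A [set y | y < c]).
  by apply: lt_nbhsl; rewrite ltrDl.
have [_ [[X [pX ->]] [UX trX]]] := clA _ (filterI nU nV).
have tr_psd_ge0 k : 0 <= \tr (X k) by apply: psdmx_trace_ge0.
exists (assemble X); split=> //.
(* The trace of the assembled matrix controls only the entries with [k.1 < k.2]; replacing the
   others by zero brings the family into [B] without changing the sum. *)
exists (fun k : 'I_p * 'I_p => if (k.1 < k.2)%N then X k else 0); last first.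
  by apply: eq_bigr => k ->.
move=> k; case: ifP => k12; last first.
  split; first exact: psdmx0.
  rewrite mxtrace0; apply: le_trans (ltW trX).
  by apply: psdmx_trace_ge0; apply: psdmx_assemble.
split=> //; apply: le_trans (ltW trX); rewrite mxtrace_assemble (bigD1 k)//=.
by rewrite lerDl sumr_ge0.
Qed.

End ClosedCone.

(** * Cone axioms, salience and interior *)

Section ProperCone.
Variables (R : realType) (N : nat) (alpha : block_partition N).
Local Notation p := (nblocks alpha).

Lemma FW2_0 : FW2 R alpha 0.
Proof.
apply/FW2P; exists (fun=> 0); split=> [k|]; first exact: psdmx0.
by rewrite /assemble big1// => k _; rewrite mulmx0 mul0mx.
Qed.

Lemma FW2_scale (a : R) (S : symmat R N) :
  0 <= a -> FW2 R alpha S -> FW2 R alpha (a *: S).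
Proof.
move=> a0 /FW2P[X [pX SX]]; apply/FW2P; exists (fun k => a *: X k); split.
  by move=> k; apply: psdmxZ.
by rewrite assembleZ -SX.
Qed.

Lemma FW2_add (S T : symmat R N) :
  FW2 R alpha S -> FW2 R alpha T -> FW2 R alpha (S + T).
Proof.
move=> /FW2P[X [pX SX]] /FW2P[Y [pY TY]]; apply/FW2P.
exists (fun k => X k + Y k); split; first by move=> k; apply: psdmxD.
by rewrite assembleD -SX -TY.
Qed.

Lemma FW2_psd (S : symmat R N) : FW2 R alpha S -> psdmx (symmat_val S).
Proof. by case/FW2P=> X [pX ->]; apply: psdmx_assemble. Qed.

(** The topology of [symmat] is induced by [symmat_val], so closedness pulls back from ['M[R]_N]. *)
Lemma FW2_closed : closed (FW2 R alpha).
Proof.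
have -> : FW2 R alpha = @symmat_val R N @^-1` [set A | exists X : pair_family R alpha,
    (forall k, psdmx (X k)) /\ A = assemble X].
  by apply/seteqP; split=> S /FW2P.
apply: preimage_closed; last exact: closed_assemble_psdmx.
by move=> S _; apply: initial_continuous.
Qed.

Lemma FW2_convex :
  convex_set (FW2 R alpha : set (convex_lmodType (symmat R N))).
Proof.
move=> S T l; rewrite !inE => FS FT.
apply: FW2_add; first exact: FW2_scale.
by apply: FW2_scale => //; rewrite subr_ge0.
Qed.

(** Both [S] and [- S] have nonnegative trace, so [S] has trace zero, and this trace bounds every
    entry. *)
Lemma FW2_salient (S : symmat R N) :
  FW2 R alpha S -> S <> 0 -> ~ FW2 R alpha (- S).
Proof.
move=> /FW2_psd pS S0 /FW2_psd pNS; apply: S0; apply/val_inj/matrixP => i j /=.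
have trS : \tr (symmat_val S) = 0.
  apply/eqP; rewrite eq_le psdmx_trace_ge0// andbT.
  by rewrite -oppr_ge0 -raddfN; apply: psdmx_trace_ge0 pNS.
by apply/eqP; rewrite mxE -normr_le0 -trS psdmx_entry_le_trace.
Qed.

Definition cover_count (a b : 'I_N) : R :=
  \sum_(k : 'I_p * 'I_p | (k.1 < k.2)%N) (in_pair k a && in_pair k b)%:R.

Lemma cover_countC a b : cover_count a b = cover_count b a.
Proof. by apply: eq_bigr => k _; rewrite andbC. Qed.

(** If [a] and [b] lie in different blocks, these form a covering pair; if they share a block, it is
    paired with any other block, which exists as [p >= 2]. *)
Lemma cover_count_ge1 a b : (2 <= p)%N -> 1 <= cover_count a b.
Proof.
move=> p2; have [k k12 /andP[ka kb]] : exists2 k : 'I_p * 'I_p, (k.1 < k.2)%N &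
    in_pair k a && in_pair k b.
  have pair (i j : 'I_p) : (i < j)%N || (j < i)%N -> block_of alpha a \in [:: i; j] ->
      block_of alpha b \in [:: i; j] ->
      exists2 k : 'I_p * 'I_p, (k.1 < k.2)%N & in_pair k a && in_pair k b.
    rewrite !inE => /orP[ij|ji] ai bi.
      by exists (i, j) => //; rewrite /in_pair ai.
    by exists (j, i) => //; rewrite /in_pair orbC ai orbC.
  have [ab|ab] := eqVneq (block_of alpha a) (block_of alpha b); last first.
    apply: (pair (block_of alpha a) (block_of alpha b)); rewrite ?inE ?eqxx ?orbT//.
    by rewrite -neq_ltn.
  (* Block 1 serves if [a] is in block 0, and block 0 otherwise. *)
  have [j aj] : exists j, j != block_of alpha a.
    have [a0|a0] := eqVneq (val (block_of alpha a)) 0%N.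
      by exists (Ordinal p2); rewrite -val_eqE/= a0.
    by exists (Ordinal (ltnW p2)); rewrite -val_eqE/= eq_sym.
  apply: (pair (block_of alpha a) j); rewrite ?inE -?ab ?eqxx//.
  by rewrite -neq_ltn eq_sym.
by rewrite /cover_count (bigD1 k)//= ka kb lerDl sumr_ge0.
Qed.

(** Each summand is [D T D] with [D = E_ij^T E_ij] a diagonal 0/1 matrix, so it keeps [T a b]
    exactly when the pair covers both indices. *)
Lemma assemble_compressionE (T : 'M[R]_N) a b :
  assemble (fun k : 'I_p * 'I_p =>
    block_row2 R k.1 k.2 *m T *m (block_row2 R k.1 k.2)^T) a b =
  cover_count a b * T a b.
Proof.
rewrite /assemble summxE mulr_suml; apply: eq_bigr => k k12.
have /(tr_block_row2_mul R) EE : k.1 != k.2 by rewrite -val_eqE neq_ltn k12.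
rewrite !mulmxA EE -!mulmxA EE mul_diag_mx mul_mx_diag !mxE -mulnb natrM; ring.
Qed.

Lemma FW2_interior : (2 <= p)%N -> (FW2 R alpha)° !=set0.
Proof.
move=> p2; pose C : 'M[R]_N := diag_mx (\row_a cover_count a a).
have sC : C \is symmetricmx by apply/symmetricmxP; rewrite tr_diag_mx.
have c_ge1 a b := cover_count_ge1 a b p2.
have c_gt0 a b : 0 < cover_count a b by apply: lt_le_trans (c_ge1 a b).
(* Chosen so that [N * e = 1 - e]: up to [N] off-diagonal entries of size [e] are dominated by a
   diagonal entry at least [1 - e]. *)
pose e : R := (N.+1%:R)^-1.
have e_gt0 : 0 < e by rewrite invr_gt0.
exists (Symmat sC); rewrite /interior /=.
have nearC : nbhs (Symmat sC) (@symmat_val R N @^-1`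
    [set B | forall a b, `|C a b - B a b| < e]).
  exact: (@initial_continuous _ _ (@symmat_val R N) (Symmat sC) _
    (nbhs_entrywise C e_gt0)).
apply: (@filterS _ _ (nbhs_filter _) _ _ _ nearC) => S SC.
pose T : 'M[R]_N := \matrix_(a, b) (symmat_val S a b / cover_count a b).
have sS a b : symmat_val S b a = symmat_val S a b.
  by have /symmetricmxP sS := valP S; rewrite -{1}sS mxE.
apply/FW2P; exists (fun k => block_row2 R k.1 k.2 *m T *m (block_row2 R k.1 k.2)^T).
split; last first.
  apply/matrixP => a b; rewrite assemble_compressionE mxE mulrC divfK//.
  by rewrite gt_eqF.
(* The compression is a congruence by [E_ij^T], so positivity of [T] suffices. *)
move=> k; rewrite -{1}[block_row2 R k.1 k.2]trmxK; apply: psdmx_congruence.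
apply: diagonally_dominant_psdmx => [|a].
  by apply/matrixP => b a; rewrite !mxE sS cover_countC.
(* Here [S a a > c - e] with [c = cover_count a a >= 1], and [(c - e) / c >= 1 - e]. *)
have diag_ge : 1 - e <= T a a.
  rewrite mxE ler_pdivlMr//; have := SC a a; rewrite !mxE eqxx mulr1n.
  rewrite ltr_norml => /andP[_ Sa]; have := c_ge1 a a; nra.
(* [C] vanishes off the diagonal, so [S a b] is below [e] in absolute value, and dividing by a count
   of at least 1 preserves the bound. *)
have off_le b : b != a -> `|T a b| <= e.
  move=> ba; have := SC a b; rewrite !mxE eq_sym (negPf ba) mulr0n sub0r normrN.
  move=> /ltW Sab; rewrite normrM normfV (gtr0_norm (c_gt0 a b)).
  by rewrite ler_pdivrMr//; apply: le_trans Sab _; rewrite ler_peMr// ltW.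
apply: le_trans diag_ge; apply: (@le_trans _ _ (\sum_(b | b != a) e)).
  exact: ler_sum.
apply: (@le_trans _ _ (\sum_(b < N) e)).
  by rewrite [leRHS](bigID (fun b => b != a))/= lerDl sumr_ge0// => b _; apply: ltW.
rewrite sumr_const card_ord -mulr_natr.
by rewrite lerBrDr -[X in _ + X]mulr1 -mulrDr natr1 mulVf.
Qed.

End ProperCone.

Theorem mainTheorem3 (R : realType) (N : nat) (alpha : block_partition N)
  (hp : (2 <= nblocks alpha)%N) :
  proper_cone (FW2 R alpha).
Proof.
split.
- by move=> a X; apply: FW2_scale.
- exact: FW2_closed.
- exact: FW2_convex.
- exact: FW2_0.
- exact: FW2_salient.
- exact: FW2_interior.
Qed.
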